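(* Let $k$ and $n_0$ be positive integers. If there exists a finite, simple, connected graph of order $n_0$ with metric dimension $k$ and exactly one metric basis, then for every integer $n\geq n_0$ there exists a finite, simple, connected graph of order $n$ with metric dimension $k$ and exactly one metric basis.
   Context: For vertices $u,v$ of a connected graph $G$, $d(u,v)$ is the distance between them. For an ordered set $W=\{w_1,\dots,w_k\}\subseteq V(G)$ and $v\in V(G)$, $r(v|W)=(d(v,w_1),\dots,d(v,w_k))$. $W$ is a resolving set if distinct vertices have distinct representations $r(\cdot|W)$. A resolving set of minimum cardinality is a metric basis; its cardinality is the metric dimension $\beta(G)$. *)

(* Defs.v *)
From mathcomp Require Import all_boot.

Set Implicit Arguments.
Unset Strict Implicit.
Unset Printing Implicit Defensive.

Record sgraph := SGraph {
  vertex :> finType;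
  adj : rel vertex;
  adj_sym : symmetric adj;
  adj_irrefl : irreflexive adj
}.

Section MetricDimension.
Variable G : sgraph.
Implicit Types (u v : G) (W : {set G}).

Definition connected : Prop := forall u v, connect (@adj G) u v.

Definition has_path_of_length u v (n : nat) : bool :=
  [exists p : n.-tuple G,
    [&& path (@adj G) u p, uniq (u :: p) & last u p == v]].

(* The first length in 0, ..., #|G| - 1 realised by a path from u to v.  A path
   has no repeated vertex, so no length is missed; the value is #|G| when u and
   v are not connected. *)
Definition dist u v : nat := find (has_path_of_length u v) (iota 0 #|G|).

Definition representation v (ws : seq G) : seq nat :=
  [seq dist v w | w <- ws].

(* Whether W resolves G does not depend on the order in which its elements are
   listed, so resolving sets are unordered and are listed as enum W.  The empty
   set is allowed: it resolves the one-vertex graph, of metric dimension 0. *)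
Definition resolving W : bool :=
  injectiveb (fun v => representation v (enum W)).

(* The default [set: G] of the arg min is resolving when G is connected. *)
Definition metric_dim : nat :=
  #|[arg min_(W < [set: G] | resolving W) #|W|]|.

Definition metric_basis W : bool := resolving W && (#|W| == metric_dim).

End MetricDimension.

(* Main.v *)
(** Attach a pendant vertex v' to a vertex v outside the unique basis W which,
    among such vertices, is farthest from a fixed w0 in W.  The set W separates
    v' from every old vertex x: otherwise d(x, w) = d(v, w) + 1 for all w in W,
    so x is not in W and is farther from w0 than v.  Conversely, replacing v'
    by v turns a resolving set of the new graph into a resolving set of the old
    one that is no larger; if it is minimum, it becomes W, which misses v, so it
    was W from the start. *)
Require Import Defs.
From mathcomp Require Import all_boot.

Set Implicit Arguments.
Unset Strict Implicit.
Unset Printing Implicit Defensive.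

(** * Distances as lengths of walks *)

Section Distance.
Variable G : sgraph.
Implicit Types (x y z : G) (p : seq G).

(** Deleting repetitions leaves a path with fewer than [#|G|] edges, a length within the range
    searched by [dist]. *)
Lemma dist_le_size x p : path (@adj G) x p -> dist x (last x p) <= size p.
Proof.
move=> xp; case/shortenP: xp => q xq uq sub_qp.
apply: leq_trans (uniq_leq_size (subseq_uniq (subseq_cons _ _) uq) sub_qp).
have qG : size q < #|G|.
  by have := max_card (mem (x :: q)); rewrite (card_uniqP uq).
rewrite /dist leqNgt; apply/negP => /(before_find 0).
rewrite nth_iota // add0n => /existsP[]; exists (in_tuple q).
by rewrite xq uq eqxx.
Qed.

Lemma dist_path x y : connect (@adj G) x y ->
  exists p, [/\ path (@adj G) x p, last x p = y & size p = dist x y].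
Proof.
case/connectP=> p /shortenP[q xq uq _] ->.
have qG : size q < #|G|.
  by have := max_card (mem (x :: q)); rewrite (card_uniqP uq).
have hasq : has (has_path_of_length x (last x q)) (iota 0 #|G|).
  apply/hasP; exists (size q); first by rewrite mem_iota.
  by apply/existsP; exists (in_tuple q); rewrite xq uq eqxx.
(* The search succeeds, so the index found is below [#|G|] and is itself the length realised. *)
have := nth_find 0 hasq; rewrite has_find size_iota in hasq.
rewrite nth_iota // add0n => /existsP[r /and3P[xr _ /eqP lr]].
by exists r; rewrite size_tuple.
Qed.

Lemma distxx x : dist x x = 0.
Proof. by apply/eqP; rewrite -leqn0 (@dist_le_size x [::]). Qed.

End Distance.

(** * Resolving sets and metric bases *)

Section ConnectedGraph.
Variable G : sgraph.
Hypothesis Gconn : connected G.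
Implicit Types (x y z : G) (W S : {set G}).

Lemma dist_eq0 x y : dist x y = 0 -> x = y.
Proof. by have [p [_ <- <-] /size0nil->] := dist_path (Gconn x y). Qed.

Lemma dist_triangle y x z : dist x z <= dist x y + dist y z.
Proof.
have [p [xp <- <-]] := dist_path (Gconn x y).
have [q [yq <- <-]] := dist_path (Gconn (last x p) z).
by rewrite -last_cat -size_cat dist_le_size // cat_path xp.
Qed.

Lemma resolvingP W :
  reflect (forall x y, {in W, forall w, dist x w = dist y w} -> x = y)
          (resolving W).
Proof.
apply: (iffP (injectiveP _)) => inj x y eq_xy; apply: inj.
  by apply/eq_in_map => w; rewrite mem_enum; apply: eq_xy.
by move=> w Ww; move/eq_in_map: eq_xy; apply; rewrite mem_enum.
Qed.

(** Each vertex of the set is the only one at distance 0 from itself, and just one vertex is left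
    over. *)
Lemma resolving_setC1 x : resolving [set~ x].
Proof.
apply/resolvingP => y z eq_yz.
have [yx | yx] := eqVneq y x; last first.
  by apply/esym/dist_eq0; rewrite -eq_yz ?distxx // !inE.
have [zx | zx] := eqVneq z x; first by rewrite yx zx.
by apply: dist_eq0; rewrite eq_yz ?distxx // !inE.
Qed.

Lemma resolvingT : resolving [set: G].
Proof.
by apply/resolvingP => x y /(_ y); rewrite inE distxx => /(_ isT)/dist_eq0.
Qed.

Lemma metric_dim_le S : resolving S -> metric_dim G <= #|S|.
Proof.
by rewrite /metric_dim; case: (arg_minnP _ resolvingT) => W _ minW /minW.
Qed.

Lemma metric_basisP W :
  reflect (resolving W /\ forall S, resolving S -> #|W| <= #|S|)
          (metric_basis W).
Proof.
apply: (iffP andP) => [[resW /eqP->] | [resW minW]]; split=> //.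
  exact: metric_dim_le.
rewrite eqn_leq metric_dim_le // andbT /metric_dim.
by case: (arg_minnP _ resolvingT) => S resS _; apply: minW.
Qed.

Lemma metric_basis_neqT x W : metric_basis W -> exists y, y \notin W.
Proof.
case/metric_basisP=> _ /(_ _ (resolving_setC1 x)) ltW.
apply/existsP; rewrite -negb_forall; apply/forallP => WT.
have WE : W = setT by apply/setP => y; rewrite inE WT.
have := subset_leqif_card (subsetT [set~ x]).
case=> _; rewrite eqn_leq -{2}WE ltW subset_leq_card ?subsetT //.
by move=> /esym/subsetP/(_ x (in_setT x)); rewrite !inE eqxx.
Qed.

End ConnectedGraph.

(** The image of a walk, without the edges that [f] collapses, is a walk that is no longer. *)
Lemma dist_contract (G H : sgraph) (f : G -> H) (x y : G) :
    connected G ->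
    (forall a b, adj a b -> f a = f b \/ adj (f a) (f b)) ->
  dist (f x) (f y) <= dist x y.
Proof.
move=> Gconn fadj; have [p [xp <- <-]] := dist_path (Gconn x y).
suff [q [xq <- szq]] : exists q,
    [/\ path (@adj H) (f x) q, last (f x) q = f (last x p) & size q <= size p].
  by apply: leq_trans szq; apply: dist_le_size.
elim: p x xp {y} => [|z p IHp] x /=; first by exists [::].
case/andP=> /fadj xz /IHp[q [zq lq szq]].
case: xz => [-> | xz]; first by exists q; split=> //; apply: leqW.
by exists (f z :: q); rewrite /= xz.
Qed.

(** * Attaching a pendant vertex *)

Section Pendant.
Variables (G : sgraph) (v : G).

Definition pendant_adj : rel (option G) := fun a b =>
  match a, b with
  | Some x, Some y => adj x y
  | Some x, None | None, Some x => x == v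
  | None, None => false
  end.

Lemma pendant_adj_sym : symmetric pendant_adj.
Proof. by case=> [x|] [y|] //=; apply: adj_sym. Qed.

Lemma pendant_adj_irrefl : irreflexive pendant_adj.
Proof. by case=> [x|] //=; apply: adj_irrefl. Qed.

Definition pendant := SGraph pendant_adj_sym pendant_adj_irrefl.

Local Notation old x := (Some x : pendant).
Local Notation new := (None : pendant).
Definition retract (a : pendant) : G := odflt v a.

Hypothesis Gconn : connected G.

Lemma pendant_connected : connected pendant.
Proof.
have csym : connect_sym (@adj pendant) by apply: sym_connect_sym (@adj_sym _).
have toV a : connect (@adj pendant) a (old v).
  case: a => [x|]; last by apply: connect1; rewrite /= eqxx.
  have /connectP[p xp ->] := Gconn x v.
  apply/connectP; exists (map Some p); last by rewrite last_map.
  by rewrite path_map.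
by move=> a b; apply: connect_trans (toV a) _; rewrite csym.
Qed.

(** Neither the inclusion [Some] nor [retract], which collapses the pendant edge, increases
    distances. *)
Lemma dist_old x y : dist (old x) (old y) = dist x y.
Proof.
apply/eqP; rewrite eqn_leq; apply/andP; split.
  by apply: (@dist_contract G pendant Some) => // a b; right.
apply: (@dist_contract pendant G retract) pendant_connected _.
by case=> [a|] [b|] //=; [right | left; apply/eqP | left; apply/esym/eqP].
Qed.

Lemma dist_new_old x : dist new (old x) = (dist v x).+1.
Proof.
apply/eqP; rewrite eqn_leq; apply/andP; split.
  rewrite -(dist_old v) -add1n.
  apply: leq_trans (dist_triangle pendant_connected (old v) _ _) _.
  by rewrite leq_add2r (@dist_le_size pendant new [:: old v]) //= eqxx.
(* A path out of the new vertex starts with the pendant edge; the rest is a walk from [v]. *)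
have [[|[y|] p] [//= pth lst <-]] := dist_path (pendant_connected new (old x)).
case/andP: pth => /eqP yv pth; rewrite ltnS -yv -dist_old -lst.
exact: dist_le_size.
Qed.

Lemma dist_old_new x : dist (old x) new = (dist x v).+1.
Proof.
apply/eqP; rewrite eqn_leq; apply/andP; split.
  rewrite -dist_old -addn1.
  apply: leq_trans (dist_triangle pendant_connected (old v) _ _) _.
  by rewrite leq_add2l (@dist_le_size pendant (old v) [:: new]) //= eqxx.
have [p [pth lst <-]] := dist_path (pendant_connected (old x) new).
(* Here the pendant edge is the last one, so the path is split at its end. *)
case/lastP: p pth lst => [//|p b]; rewrite rcons_path last_rcons => + bE.
rewrite {}bE size_rcons ltnS; case/andP=> pth.
case E: (last _ p) => [y|//] /eqP yv.
by rewrite -yv -dist_old -E dist_le_size.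
Qed.

(** The correction term does not depend on [x], so it cancels when two old vertices are compared. *)
Lemma dist_old_retract x a : dist (old x) a = dist x (retract a) + (a == new).
Proof. by case: a => [y|]; rewrite ?dist_old ?dist_old_new ?addn0 ?addn1. Qed.

Lemma resolving_retract (S : {set pendant}) :
  resolving S -> resolving (retract @: S).
Proof.
move/resolvingP=> resS; apply/resolvingP => x y eq_xy.
suff [] : old x = old y by [].
by apply: resS => s Ss; rewrite !dist_old_retract eq_xy // imset_f.
Qed.

Lemma resolving_pendant (W : {set G}) (w0 : G) :
    w0 \in W -> v \notin W ->
    (forall x, x \notin W -> dist x w0 <= dist v w0) ->
  resolving W -> resolving (Some @: W : {set pendant}).
Proof.
move=> Ww0 Wv vmax /resolvingP resW.
have new_old x :
    ~ {in (Some @: W : {set pendant}), forall w, dist new w = dist (old x) w}.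
  move=> eq_x.
  have dx w : w \in W -> (dist v w).+1 = dist x w.
    by move=> Ww; rewrite -dist_new_old -dist_old eq_x // imset_f.
  (* If [x] were in [W], taking [w] to be [x] in [dx] would make a successor equal to 0. *)
  have Wx : x \notin W by apply/negP => /dx; rewrite distxx.
  by have := vmax x Wx; rewrite -dx // ltnn.
apply/resolvingP => -[x|] [y|] // eq_xy.
- congr Some; apply: resW => w Ww.
  by rewrite -!dist_old eq_xy // imset_f.
- by case: (new_old x) => w Ww; rewrite eq_xy.
- by case: (new_old y).
Qed.

Lemma pendant_unique_basis (W : {set G}) (w0 : G) :
    w0 \in W -> v \notin W ->
    (forall x, x \notin W -> dist x w0 <= dist v w0) ->
    unique (fun S : {set G} => metric_basis S) W ->
  unique (fun S : {set pendant} => metric_basis S) (Some @: W).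
Proof.
move=> Ww0 Wv vmax [/(metric_basisP Gconn)[resW minW] uniqW].
have cardW : #|(Some @: W : {set pendant})| = #|W|.
  by rewrite card_imset //; apply: Some_inj.
have resW' := resolving_pendant Ww0 Wv vmax resW.
split.
  apply/(metric_basisP pendant_connected); split=> // S /resolving_retract resS.
  by rewrite cardW (leq_trans (minW _ resS)) ?leq_imset_card.
move=> S /(metric_basisP pendant_connected)[resS /(_ _ resW') leSW].
(* The image resolves [G] and has at most [#|W|] elements, so it is a basis and uniqueness
   applies. *)
have WE : W = retract @: S.
  apply/uniqW/(metric_basisP Gconn); split; first exact: resolving_retract.
  move=> T /minW; apply: leq_trans; rewrite -cardW.
  exact: leq_trans (leq_imset_card _ _) leSW.
(* Since [W] is an image of [S], [S] has at least [#|W|] elements, and one inclusion suffices. *)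
apply/esym/eqP; rewrite eqEcard cardW andbC {1}WE leq_imset_card /=.
apply/subsetP => s Ss.
have : retract s \in W by rewrite WE imset_f.
case: s Ss => [x|] _ /= ; first exact: imset_f.
(* The new vertex retracts to [v], so its presence in [S] would put [v] in [W]. *)
by rewrite (negPf Wv).
Qed.

End Pendant.

Lemma unique_basis_succ (k n : nat) : 0 < k ->
  (exists G : sgraph,
     [/\ connected G, #|G| = n, metric_dim G = k
       & exists! W : {set G}, metric_basis W]) ->
  exists G : sgraph,
     [/\ connected G, #|G| = n.+1, metric_dim G = k
       & exists! W : {set G}, metric_basis W].
Proof.
move=> k_gt0 [G [Gconn cardG dimG [W Wuniq]]].
have [Wbasis _] := Wuniq; have /andP[_ /eqP cardW] := Wbasis.
(* Positivity of [k] supplies the reference vertex [w0]; next, [v0] shows that the maximum defining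
   [v] ranges over a nonempty set. *)
have /card_gt0P[w0 Ww0] : 0 < #|W| by rewrite cardW dimG.
have [v0 Wv0] := metric_basis_neqT Gconn w0 Wbasis.
case: (@arg_maxnP _ v0 (fun x => x \notin W) (fun x => dist x w0) Wv0).
move=> v Wv vmax; have W'uniq := pendant_unique_basis Gconn Ww0 Wv vmax Wuniq.
exists (pendant v); split; last by exists (Some @: W).
- exact: pendant_connected.
- by rewrite card_option cardG.
- have [/andP[_ /eqP <-] _] := W'uniq.
  by rewrite card_imset ?cardW //; apply: Some_inj.
Qed.

Theorem theorem6 (k n0 : nat) (k_gt0 : 0 < k) (n0_gt0 : 0 < n0) :
  (exists G : sgraph,
     [/\ connected G, #|G| = n0, metric_dim G = k
       & exists! W : {set G}, metric_basis W]) ->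
  forall n : nat, n0 <= n ->
  exists G : sgraph,
    [/\ connected G, #|G| = n, metric_dim G = k
      & exists! W : {set G}, metric_basis W].
Proof.
(* One pendant vertex is added for each unit of [n - n0]. *)
move=> exG n /subnK <-; elim: (n - n0) => [//|m IHm].
exact: unique_basis_succ.
Qed.
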